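(* Let $\mathcal G$ be a directed acyclic graph on the vertex set $V=\{X_1,\dots,X_r\}$ and let $\mathcal T=\{P(v\mid \mathrm{pa}(v)) : v\in V\}\cup\{N\}$ be the set of conditional and marginal distributions (a marginal when $\mathrm{pa}(v)=\emptyset$) given by $\mathcal G$, together with the grand total $N$, observed from an $r$-way contingency table $\mathbf n^0$ of nonnegative integers with grand total $N$ in which all marginal counts of configurations of $\mathrm{pa}(v)$, $v\in V$, are positive. Let $\mathcal G^u$ be the undirected graph associated with $\mathcal T$. If $\mathcal G$ satisfies the Wermuth condition, then the bounds on the cell entries imposed by $\mathcal T$ are the same as the bounds on the cell entries imposed by the set of marginals associated with $\mathcal G^u$.
   Context: $X_1,\dots,X_r$ are categorical variables with finitely many levels each; a table is an array of nonnegative integer counts indexed by the level combinations (cells). For $v\in V$, $\mathrm{pa}(v)$ is the set of parents of $v$ in $\mathcal G$. The undirected graph $\mathcal G^u$ associated with $\mathcal T$ is the graph on $V$ obtained from $\mathcal G$ by replacing every directed edge by an undirected edge. The DAG $\mathcal G$ satisfies the Wermuth condition (is perfect) if no child has two parents that are not directly connected by an edge. The set of marginals associated with $\mathcal G^u$ is the collection of marginal tables of $\mathbf n^0$ over the maximal cliques of $\mathcal G^u$. A table $\mathbf n$ is consistent with $\mathcal T$ if it has grand total $N$, all its marginal counts of configurations of $\mathrm{pa}(v)$ are positive, and its empirical conditional distributions of $v$ given $\mathrm{pa}(v)$ equal those of $\mathbf n^0$ for all $v\in V$; it is consistent with the set of marginals associated with $\mathcal G^u$ if it has the same marginal tables as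 $\mathbf n^0$ over all maximal cliques of $\mathcal G^u$. The bounds on a cell entry imposed by a set of constraints are the minimum and the maximum of that cell's count over all tables of nonnegative integers consistent with these constraints. *)

(* Defs.v *)
From mathcomp Require Import all_boot all_order all_algebra.

Set Implicit Arguments.
Unset Strict Implicit.
Unset Printing Implicit Defensive.

Import GRing.Theory.

(* A directed graph on [V] is a relation [e], with [e u v] meaning u -> v. *)
Section Graphs.
Variables (V : finType) (e : rel V).

(* Excludes self-loops too: [:: v] is an [e]-cycle iff [e v v]. *)
Definition acyclic : Prop := forall s : seq V, cycle e s -> s = [::].

Definition parents (v : V) : {set V} := [set u | e u v].

Definition undirected : rel V := [rel u v | e u v || e v u].

Definition wermuth : Prop :=
  forall v u w : V, u \in parents v -> w \in parents v -> u != w ->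
    e u w || e w u.

End Graphs.

Definition clique (V : finType) (g : rel V) (C : {set V}) : bool :=
  [forall u in C, forall v in C, (u != v) ==> g u v].

Definition maximal_clique (V : finType) (g : rel V) (C : {set V}) : bool :=
  maxset (clique g) C.

Section Tables.
Variables (r : nat) (L : 'I_r -> finType).

Definition cell := {dffun forall i : 'I_r, L i}.

Definition table := {ffun cell -> nat}.

Definition config (A : {set 'I_r}) :=
  {dffun forall i : {i : 'I_r | i \in A}, L (val i)}.

Definition restrict (A : {set 'I_r}) (x : cell) : config A :=
  [ffun i : {i : 'I_r | i \in A} => x (val i)].

Definition grand_total (n : table) : nat := \sum_(x : cell) n x.

Definition marginal (n : table) (A : {set 'I_r}) : {ffun config A -> nat} :=
  [ffun a => \sum_(x : cell | restrict A x == a) n x].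

Variable e : rel 'I_r.

(* Empirical P(v = a | pa(v) = b). For a parentless [v], [b] is the unique
   empty configuration and this is the relative frequency of v = a. *)
Definition conditional (n : table) (v : 'I_r)
    (b : config (parents e v)) (a : L v) : rat :=
  ((\sum_(x : cell | (restrict (parents e v) x == b) && (x v == a)) n x)%N%:R
   / (marginal n (parents e v) b)%:R)%R.

Definition positive_parent_marginals (n : table) : Prop :=
  forall (v : 'I_r) (b : config (parents e v)),
    0 < marginal n (parents e v) b.

Definition consistent_conditionals (N : nat) (n0 n : table) : Prop :=
  [/\ grand_total n = N,
      positive_parent_marginals n
    & forall (v : 'I_r) (b : config (parents e v)) (a : L v),
        conditional n b a = conditional n0 b a].

Definition consistent_marginals (n0 n : table) : Prop :=
  forall C : {set 'I_r}, maximal_clique (undirected e) C ->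
    marginal n C = marginal n0 C.

End Tables.

(* [lo] and [hi] are the attained minimum and maximum of the count of [x]
   over the tables satisfying [P]. *)
Definition cell_bounds (r : nat) (L : 'I_r -> finType) (P : table L -> Prop)
    (x : cell L) (lo hi : nat) : Prop :=
  [/\ exists2 n : table L, P n & n x = lo,
      exists2 n : table L, P n & n x = hi
    & forall n : table L, P n -> lo <= n x <= hi].

(* Main.v *)
Require Import Defs.
From mathcomp Require Import all_boot all_order all_algebra.

(** The two constraint sets are satisfied by the same tables, so they impose
    the same bounds; the bounds exist because the common set of tables is
    finite and contains [n0].

    Call a vertex set complete if it is a clique of the undirected graph.  Two
    facts about an acyclic [e] satisfying the Wermuth condition link cliques
    to conditionals.  Every family, that is, a vertex with its parents, is
    complete ([clique_family]); and every nonempty complete set lies inside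
    the family of its last vertex in an ancestral order
    ([clique_sub_family]).  Hence knowing the marginals over the maximal
    cliques, over all complete sets, or over all families is the same thing,
    the empty set accounting for the grand total.

    Marginals determine conditionals because [P(v | pa(v))] is the quotient of
    the family marginal by the marginal over [pa(v)], and both sets are
    complete ([marginals_conditionals]).  Conversely the conditionals and [N]
    determine all family marginals, by induction along an ancestral order: the
    marginal over [pa(v)] is already known, since [pa(v)] is either empty, with
    marginal [N], or contained in the family of an earlier vertex; multiplying
    it by the conditional gives the marginal over the family of [v]
    ([conditionals_family_marginal]). *)

Set Implicit Arguments.
Unset Strict Implicit.
Unset Printing Implicit Defensive.

Import GRing.Theory Num.Theory.

(** * Cliques and families in a perfect directed acyclic graph *)

Section PerfectGraphs.

Variables (V : finType) (e : rel V).

Definition family (v : V) : {set V} := v |: parents e v.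

(** The number of ancestors serves as a numerical ancestral order: it
    increases strictly along every edge of an acyclic graph. *)
Definition depth (v : V) : nat := #|[set u | connect e u v]|.

Lemma cliqueP (g : rel V) (C : {set V}) :
  reflect {in C &, forall u v, u != v -> g u v} (clique g C).
Proof.
apply: (iffP forall_inP) => [gC u v uC vC uv | gC u uC].
  by have /forall_inP/(_ v vC)/implyP := gC u uC; apply.
by apply/forall_inP => v vC; apply/implyP; apply: gC.
Qed.

Hypothesis acyclic_e : acyclic e.

Lemma depth_edge (u v : V) : e u v -> depth u < depth v.
Proof.
move=> euv; apply: proper_card; apply/properP; split.
  by apply/subsetP => w; rewrite !inE => /connect_trans; apply; apply: connect1.
exists v; rewrite inE ?connect0 //; apply/negP => /connectP [p vp def_u].
by have := acyclic_e (s := v :: p); rewrite /= rcons_path vp -def_u euv => /(_ isT).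
Qed.

(** A vertex of maximal depth in a complete set has every other vertex of the
    set as a parent, since an edge in the other direction would lead to a
    deeper vertex. *)
Lemma clique_sub_family (C : {set V}) :
  clique (undirected e) C -> C != set0 ->
  exists2 v, v \in C & C \subset family v.
Proof.
move=> /cliqueP gC /set0Pn [v0 v0C].
case: (arg_maxnP depth v0C) => v vC vmax; exists v => //.
apply/subsetP => u uC; rewrite !inE; have [//|uv] /= := eqVneq u v.
case/orP: (gC u v uC vC uv) => // /depth_edge.
by have /= := vmax u uC; rewrite ltnNge => ->.
Qed.

Hypothesis wermuth_e : wermuth e.

Lemma clique_parents (v : V) : clique (undirected e) (parents e v).
Proof. by apply/cliqueP => u w; apply: wermuth_e. Qed.

Lemma clique_family (v : V) : clique (undirected e) (family v).
Proof.
apply/cliqueP => u w /setU1P [->|uv] /setU1P [->|wv]; rewrite ?eqxx //= => uw.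
- by apply/orP; right; move: wv; rewrite inE.
- by apply/orP; left; move: uv; rewrite inE.
- exact: wermuth_e uv wv uw.
Qed.

End PerfectGraphs.

(** * Marginals as sums over events *)

Section Marginals.

Variables (r : nat) (L : 'I_r -> finType).
Implicit Types (n m : table L) (A B : {set 'I_r}) (P : pred (cell L)).

Lemma restrict_eqP A (x y : cell L) :
  reflect {in A, forall i, x i = y i} (restrict A x == restrict A y).
Proof.
apply: (iffP eqP) => [xy i iA | xy].
  by move/ffunP/(_ (exist _ i iA)): xy; rewrite !ffunE.
by apply/ffunP => -[i iA]; rewrite !ffunE; apply: xy.
Qed.

Definition determined_by A P : Prop :=
  forall x y : cell L, {in A, forall i, x i = y i} -> P x = P y.

Lemma determined_by_restrict A B (b : config L A) :
  A \subset B -> determined_by B [pred x | restrict A x == b].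
Proof.
move=> /subsetP AB x y xy /=; congr (_ == _); apply/eqP/restrict_eqP => i iA.
exact/xy/AB.
Qed.

(** An event that depends only on the coordinates in [A] is a disjoint union
    of fibres of the restriction to [A], and the counts of these fibres are the
    entries of the marginal over [A].  Submarginals, the grand total and the
    numerators of the conditionals are all counts of such events. *)
Lemma marginal_event n m A P :
  marginal n A = marginal m A -> determined_by A P ->
  \sum_(x | P x) n x = \sum_(x | P x) m x.
Proof.
move=> nm PA; rewrite !(partition_big (@restrict r L A) predT) //=.
apply: eq_bigr => a _.
have [x /andP [Px /eqP xa] | noP] := pickP [pred x | P x && (restrict A x == a)].
  have PE y : P y && (restrict A y == a) = (restrict A y == a).
    apply/andb_idl => /eqP ya; rewrite (PA y x) //.
    by apply/restrict_eqP; rewrite xa ya.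
  by move/ffunP/(_ a): nm; rewrite !ffunE !(eq_bigl _ _ PE).
by rewrite !big_pred0.
Qed.

Lemma marginalS n m A B :
  A \subset B -> marginal n B = marginal m B -> marginal n A = marginal m A.
Proof.
move=> AB nm; apply/ffunP => a; rewrite !ffunE.
exact: marginal_event nm (determined_by_restrict a AB).
Qed.

Lemma marginal0 n m :
  marginal n set0 = marginal m set0 <-> grand_total n = grand_total m.
Proof.
split=> [nm | nm].
  exact: (marginal_event (P := predT) nm).
apply/ffunP => a; rewrite !ffunE.
have aE (x : cell L) : (restrict set0 x == a) = true.
  by apply/eqP/ffunP => -[i i0]; exfalso; rewrite inE in i0.
by rewrite !(eq_bigl _ _ aE).
Qed.

Lemma leq_grand_total n (x : cell L) : n x <= grand_total n.
Proof. by rewrite /grand_total (bigD1 x) //= leq_addr. Qed.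

(** The tables satisfying [P] form a finite set, as their entries are at most
    [N]; representing them as functions into ['I_N.+1] turns the search for the
    extreme values of a cell into one over a finite type. *)
Lemma cell_bounds_exist (P : pred (table L)) (N : nat) n (x : cell L) :
  P n -> (forall m, P m -> grand_total m = N) ->
  exists lo hi, cell_bounds P x lo hi.
Proof.
move=> Pn totP.
pose table_of (t : {ffun cell L -> 'I_N.+1}) : table L :=
  [ffun y => t y : nat].
have table_ofP m : P m -> exists t, table_of t = m.
  move=> Pm; exists [ffun y => inord (m y)]; apply/ffunP => y.
  by rewrite !ffunE inordK // ltnS -(totP m Pm) leq_grand_total.
have [t def_n] := table_ofP n Pn.
have Pt : [pred t | P (table_of t)] t by rewrite /= def_n.
case: (arg_minnP (fun t => table_of t x) Pt) => tlo Plo lo_min.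
case: (arg_maxnP (fun t => table_of t x) Pt) => thi Phi hi_max.
exists (table_of tlo x), (table_of thi x); split; first by exists (table_of tlo).
  by exists (table_of thi).
move=> m Pm; have [s def_m] := table_ofP m Pm.
have Ps : P (table_of s) by rewrite def_m.
by rewrite -def_m (lo_min s Ps); apply: hi_max s Ps.
Qed.

Lemma eq_cell_bounds (P Q : table L -> Prop) (x : cell L) (lo hi : nat) :
  (forall n, P n <-> Q n) -> cell_bounds P x lo hi -> cell_bounds Q x lo hi.
Proof.
move=> PQ [[n Pn nx] [m Pm mx] bnd]; split.
- by exists n => //; apply/PQ.
- by exists m => //; apply/PQ.
- by move=> k /PQ; apply: bnd.
Qed.

End Marginals.

(** * Conditionals and clique marginals determine each other *)

Section Equivalence.

Variables (r : nat) (L : 'I_r -> finType) (e : rel 'I_r).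
Implicit Types (n m : table L) (A C : {set 'I_r}).

(** Every complete set extends to a maximal clique, whose marginal determines
    the marginals over its subsets. *)
Lemma marginals_clique n0 n C :
  consistent_marginals e n0 n -> clique (undirected e) C ->
  marginal n C = marginal n0 C.
Proof.
move=> nn0 cC; have [D maxD CD] := maxset_exists cC.
exact: marginalS CD (nn0 D maxD).
Qed.

Lemma determined_by_family (v : 'I_r) (b : config L (parents e v)) (a : L v) :
  determined_by (family e v)
    [pred x : cell L | (restrict (parents e v) x == b) && (x v == a)].
Proof.
move=> x y xy /=; rewrite (xy v (setU11 _ _)).
congr (_ && _).
exact: (determined_by_restrict b (subsetUr [set v] (parents e v)) xy).
Qed.

Lemma conditional_eq n m (v : 'I_r) :
  marginal n (family e v) = marginal m (family e v) ->
  forall (b : config L (parents e v)) (a : L v),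
  conditional n b a = conditional m b a.
Proof.
move=> nm b a; rewrite /conditional.
rewrite (marginal_event nm (determined_by_family b a)).
by rewrite (marginalS (subsetUr _ _) nm).
Qed.

(** The entry of the family marginal at the configuration of a cell [x] is the
    numerator of a conditional, and is recovered from the conditional by
    clearing the denominator. *)
Lemma marginal_family n m (v : 'I_r) :
  (forall b : config L (parents e v), 0 < marginal m (parents e v) b) ->
  marginal n (parents e v) = marginal m (parents e v) ->
  (forall (b : config L (parents e v)) (a : L v),
     conditional n b a = conditional m b a) ->
  marginal n (family e v) = marginal m (family e v).
Proof.
move=> pos nm cond; apply/ffunP => c; rewrite !ffunE.
have [x /eqP <- | noc] := pickP [pred x : cell L | restrict (family e v) x == c];
  last by rewrite !big_pred0.
have famE (y : cell L) : (restrict (family e v) y == restrict (family e v) x) =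
    (restrict (parents e v) y == restrict (parents e v) x) && (y v == x v).
  apply/restrict_eqP/andP => [yx | [/restrict_eqP yx /eqP yxv] i /setU1P [-> //|/yx //]].
  split; last by rewrite yx ?setU11.
  by apply/restrict_eqP => i iv; apply/yx/setU1r.
rewrite !(eq_bigl _ _ famE).
have := cond (restrict (parents e v) x) (x v); rewrite /conditional nm.
have den_neq0 : ((marginal m (parents e v) (restrict (parents e v) x))%:R != 0 :> rat)%R.
  by rewrite pnatr_eq0 -lt0n.
by move/(divIf den_neq0)/eqP; rewrite eqr_nat => /eqP.
Qed.

Hypotheses (acyclic_e : acyclic e) (wermuth_e : wermuth e).
Variable n0 : table L.
Hypothesis n0_pos : positive_parent_marginals e n0.

Lemma marginals_conditionals n :
  consistent_marginals e n0 n ->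
  consistent_conditionals e (grand_total n0) n0 n.
Proof.
move=> nn0; split.
- apply/marginal0/(marginals_clique nn0)/cliqueP => u v.
  by rewrite inE.
- move=> v b; rewrite (marginals_clique nn0) //; exact: clique_parents.
- move=> v; apply: conditional_eq.
  exact/(marginals_clique nn0)/clique_family.
Qed.

(** The parents of [v] form a complete set, hence lie in the family of a parent
    of [v], whose depth is smaller, unless [v] has no parents. *)
Lemma conditionals_family_marginal n :
  consistent_conditionals e (grand_total n0) n0 n ->
  forall v, marginal n (family e v) = marginal n0 (family e v).
Proof.
move=> [tot _ cond] v.
have [k] := ubnP (depth e v); elim: k v => // k IHk v; rewrite ltnS => vk.
apply: marginal_family; [exact: n0_pos | | exact: cond].
have [->|pa_neq0] := eqVneq (parents e v) set0; first exact/marginal0.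
have [w] := clique_sub_family acyclic_e (clique_parents wermuth_e v) pa_neq0.
rewrite inE => ewv pa_w; apply: marginalS pa_w _; apply: IHk.
exact: leq_trans (depth_edge acyclic_e ewv) vk.
Qed.

Lemma conditionals_marginals n :
  consistent_conditionals e (grand_total n0) n0 n ->
  consistent_marginals e n0 n.
Proof.
move=> nn0 C /maxsetp cC; have [tot _ _] := nn0.
have [->|C_neq0] := eqVneq C set0; first exact/marginal0.
have [v _ C_v] := clique_sub_family acyclic_e cC C_neq0.
exact: marginalS C_v (conditionals_family_marginal nn0 v).
Qed.

End Equivalence.

Theorem theorem3p5 (r : nat) (L : 'I_r -> finType) (e : rel 'I_r)
    (N : nat) (n0 : table L) :
  acyclic e ->
  grand_total n0 = N ->
  positive_parent_marginals e n0 ->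
  wermuth e ->
  forall x : cell L, exists lo hi : nat,
    cell_bounds (consistent_conditionals e N n0) x lo hi /\
    cell_bounds (consistent_marginals e n0) x lo hi.
Proof.
move=> acyc <- pos wer x.
pose P : pred (table L) := fun n =>
  [forall (C : {set 'I_r} | maximal_clique (undirected e) C),
     marginal n C == marginal n0 C].
have PP n : P n <-> consistent_marginals e n0 n.
  split=> [/forall_inP nn0 C maxC | nn0]; first exact/eqP/nn0.
  by apply/forall_inP => C maxC; apply/eqP/nn0.
have PQ n : P n <-> consistent_conditionals e (grand_total n0) n0 n.
  split=> [/PP | nn0]; first exact: marginals_conditionals.
  exact/PP/conditionals_marginals.
have Pn0 : P n0 by apply/PP.
have totP n : P n -> grand_total n = grand_total n0 by case/PQ.
have [lo [hi bnd]] := cell_bounds_exist x Pn0 totP.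
by exists lo, hi; split; apply: eq_cell_bounds bnd.
Qed.
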